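(* In the class of solvable Leibniz algebras, being triangulable is a 2-recognizable property; that is, if $A$ is a finite-dimensional solvable Leibniz algebra over a field $F$ such that every subalgebra of $A$ generated by two elements is triangulable, then $A$ is triangulable.
   Context: A Leibniz algebra over a field $F$ is an $F$-vector space $A$ with a bilinear product satisfying the (left) Leibniz identity $x(yz) = (xy)z + y(xz)$ for all $x,y,z \in A$. $A$ is solvable if its derived series $A^{(0)} = A$, $A^{(i+1)} = A^{(i)}A^{(i)}$ (span of products) reaches $0$. Let $K$ be the algebraic closure of $F$. A finite-dimensional Leibniz algebra $N$ over $F$ is called triangulable (on itself) if $K \otimes_F N$, a Leibniz algebra over $K$, has a $K$-basis with respect to which the matrices of all left multiplications $a \mapsto xa$ and all right multiplications $a \mapsto ax$, $x \in K \otimes_F N$, are upper triangular; a subalgebra is called triangulable when it is triangulable on itself. A property is $n$-recognizable in a class of algebras if, whenever all $n$-generated subalgebras of an algebra in the class have the property, then the algebra has the property. *)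

(* Defs.v *)
From HB Require Import structures.
From mathcomp Require Import all_boot all_algebra.

Set Implicit Arguments.
Unset Strict Implicit.
Unset Printing Implicit Defensive.

Import GRing.Theory.
Local Open Scope ring_scope.

Reserved Notation "x ** y" (at level 40, left associativity).

HB.mixin Record Vector_isLeibniz (F : fieldType) A & Vector F A := {
  lmul : A -> A -> A;
  lmul_linear_l : forall y, linear (lmul ^~ y);
  lmul_linear_r : forall x, linear (lmul x);
  lmul_leibniz : forall x y z,
    lmul x (lmul y z) = lmul (lmul x y) z + lmul y (lmul x z)
}.

#[short(type="leibnizType")]
HB.structure Definition Leibniz (F : fieldType) :=
  {A of Vector F A & Vector_isLeibniz F A}.

Notation "x ** y" := (lmul x y) : ring_scope.

Section ProductLinearity.
Variables (F : fieldType) (A : leibnizType F).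

HB.instance Definition _ (x : A) :=
  GRing.isLinear.Build F A A _ (lmul x) (lmul_linear_r x).

Definition rmul (y x : A) : A := x ** y.
HB.instance Definition _ (y : A) :=
  GRing.isLinear.Build F A A _ (rmul y) (lmul_linear_l y).

End ProductLinearity.

Section Solvable.
Variables (F : fieldType) (A : leibnizType F).
Implicit Types U V W : {vspace A}.

(* The span of all products is already the span of the products of basis
   vectors, see sprod_subP. *)
Definition sprod U V : {vspace A} :=
  <<[seq u ** v | u <- vbasis U, v <- vbasis V]>>%VS.

Lemma sprod_subP U V W :
  reflect {in U & V, forall u v, u ** v \in W} (sprod U V <= W)%VS.
Proof.
apply: (iffP idP) => [/subvP sUVW u v uU vV | UVW]; last first.
  by apply/span_subvP=> _ /allpairsP[[u v] [uU vV ->]]; apply: UVW;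
     apply: vbasis_mem.
rewrite (coord_vbasis uU) (coord_vbasis vV) -/(rmul _ _) linear_sum.
apply: memv_suml => i _; rewrite linearZ /= rpredZ // /rmul linear_sum.
apply: memv_suml => j _; rewrite linearZ /= rpredZ //.
by apply: sUVW; apply/memv_span/allpairs_f; apply: mem_nth; rewrite size_tuple.
Qed.

Definition derived_series (i : nat) : {vspace A} :=
  iter i (fun U => sprod U U) {:A}%VS.

Definition solvable_leibniz : Prop := exists i, derived_series i = 0%VS.

End Solvable.

Section Subalgebra.
Variables (F : fieldType) (A : leibnizType F).

Record subalgebra := Subalgebra {
  subalgebra_space :> {vspace A};
  subalgebra_closed :
    {in subalgebra_space &, forall x y, x ** y \in subalgebra_space}
}.

Definition subalg_of (S : subalgebra) : Type := subvs_of S.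

Section SubalgebraLeibniz.
Variable S : subalgebra.

HB.instance Definition _ := Vector.copy (subalg_of S) (subvs_of S).

Definition subalg_mul (x y : subalg_of S) : subalg_of S :=
  Subvs (subalgebra_closed (subvsP x) (subvsP y)).

Fact subalg_mul_linear_l y : linear (subalg_mul ^~ y).
Proof. by move=> a u v; apply: val_inj; rewrite /= lmul_linear_l. Qed.

Fact subalg_mul_linear_r x : linear (subalg_mul x).
Proof. by move=> a u v; apply: val_inj; rewrite /= lmul_linear_r. Qed.

Fact subalg_mul_leibniz x y z :
  subalg_mul x (subalg_mul y z)
  = subalg_mul (subalg_mul x y) z + subalg_mul y (subalg_mul x z).
Proof. by apply: val_inj; rewrite /= lmul_leibniz. Qed.

HB.instance Definition _ := Vector_isLeibniz.Build F (subalg_of S)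
  subalg_mul_linear_l subalg_mul_linear_r subalg_mul_leibniz.

End SubalgebraLeibniz.

Definition is_generated_by (S : subalgebra) (X : seq A) : Prop :=
  {subset X <= S} /\
  forall T : subalgebra, {subset X <= T} -> (S <= T)%VS.

Lemma generated_subalgebra_exists (X : seq A) :
  exists S : subalgebra, is_generated_by S X.
Proof.
pose step (U : {vspace A}) := (U + sprod U U)%VS; pose G k := iter k step <<X>>%VS.
have G_incr k : (G k <= G k.+1)%VS by rewrite /G /= addvSl.
have G_min (T : subalgebra) k : {subset X <= T} -> (G k <= T)%VS.
  move=> sXT; elim: k => [|k IHk]; first exact/span_subvP.
  rewrite /G /= subv_add IHk; apply/sprod_subP=> u v /(subvP IHk) uT.
  by move=> /(subvP IHk); apply: subalgebra_closed.
have [k Gk]: exists k, (G k.+1 <= G k)%VS.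
  suff /existsP[k Gk]: [exists k : 'I_(\dim {:A}).+1, (G k.+1 <= G k)%VS].
    by exists k.
  apply: contraT; rewrite negb_exists => /forallP nG.
  have dimG m : (m <= (\dim {:A}).+1 -> m <= \dim (G m))%N.
    elim: m => // m IHm lt_m; apply: leq_ltn_trans (IHm (ltnW lt_m)) _.
    rewrite (ltn_leqif (dimv_leqif_sup (G_incr m))).
    exact: (nG (Ordinal lt_m)).
  by have := leq_trans (dimG _ (leqnn _)) (dimvS (subvf _)); rewrite ltnn.
have clG: {in G k &, forall x y, x ** y \in G k}.
  by apply/sprod_subP; apply: subv_trans Gk; rewrite /G /= addvSr.
exists (Subalgebra clG); split=> [x xX | T sXT] /=; last exact: G_min.
have /subvP: (G 0%N <= G k)%VS.
  by elim: (k) => // m IHm; apply: subv_trans IHm (G_incr m).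
by apply; apply: memv_span.
Qed.

End Subalgebra.

Section ScalarExtension.
Variables (F K : fieldType) (iota : {rmorphism F -> K}) (N : leibnizType F).

(* K (x)_F N in coordinates: x stands for \sum_i x 0 i (x) e_i, where e is the
   basis vbasis {:N} of N, and scalar_ext_mul is the K-bilinear extension of
   the structure constants of N with respect to e. *)
Definition scalar_ext of {rmorphism F -> K} : Type := 'rV[K]_(\dim {:N}).

Local Notation NK := (scalar_ext iota).
Local Notation e := (vbasis {:N}).

HB.instance Definition _ := Vector.copy NK 'rV[K]_(\dim {:N}).

Definition scalar_ext_mul (x y : NK) : NK :=
  \row_k \sum_i \sum_j x 0 i * y 0 j * iota (coord e k (e`_i ** e`_j)).

(* v |-> 1 (x) v *)
Definition scalar_ext_in (v : N) : NK := \row_k iota (coord e k v).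

Fact scalar_ext_mul_linear_l y : linear (scalar_ext_mul ^~ y).
Proof.
move=> a u v; apply/rowP=> k; rewrite !mxE mulr_sumr -big_split /=.
apply: eq_bigr => i _; rewrite mulr_sumr -big_split /=.
by apply: eq_bigr => j _; rewrite !mxE !mulrDl !mulrA.
Qed.

Fact scalar_ext_mul_linear_r x : linear (scalar_ext_mul x).
Proof.
move=> a u v; apply/rowP=> k; rewrite !mxE mulr_sumr -big_split /=.
apply: eq_bigr => i _; rewrite mulr_sumr -big_split /=.
apply: eq_bigr => j _; rewrite !mxE mulrDr mulrDl !mulrA.
by rewrite [x 0 i * a]mulrC.
Qed.

Fact scalar_ext_in_mul u v :
  scalar_ext_in (u ** v) = scalar_ext_mul (scalar_ext_in u) (scalar_ext_in v).
Proof.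
apply/rowP=> k; rewrite !mxE {1}(coord_vbasis (memvf u)).
rewrite {1}(coord_vbasis (memvf v)) -/(rmul _ _) !linear_sum /= rmorph_sum.
apply: eq_bigr => i _; rewrite linearZ /= /rmul linear_sum linearZ linear_sum /=.
rewrite mulr_sumr rmorph_sum; apply: eq_bigr => j _.
by rewrite linearZ linearZ /= !mxE !rmorphM mulrA.
Qed.

Fact scalar_ext_inD u v :
  scalar_ext_in (u + v) = scalar_ext_in u + scalar_ext_in v.
Proof. by apply/rowP=> k; rewrite !mxE linearD rmorphD. Qed.

Fact scalar_ext_sum (x : NK) : x = \sum_i x 0 i *: scalar_ext_in e`_i.
Proof.
apply/rowP=> k; rewrite summxE (bigD1 k) //= !mxE.
have fe: free e by apply: basis_free (vbasisP _).
rewrite coord_free // eqxx rmorph1 mulr1 big1 ?addr0 // => i ik.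
by rewrite !mxE coord_free // (negPf ik) rmorph0 mulr0.
Qed.

Fact scalar_ext_mul_leibniz x y z :
  scalar_ext_mul x (scalar_ext_mul y z)
  = scalar_ext_mul (scalar_ext_mul x y) z
    + scalar_ext_mul y (scalar_ext_mul x z).
Proof.
have sumE (h : NK -> NK) (hlin : linear h) I r (c : I -> K) (f : I -> NK) :
    h (\sum_(i <- r) c i *: f i) = \sum_(i <- r) c i *: h (f i).
  pose g : {linear NK -> NK} :=
    HB.pack h (GRing.isLinear.Build K NK NK _ h hlin).
  have gE : h =1 g by [].
  by rewrite gE linear_sum; apply: eq_bigr => i _; rewrite linearZ.
have Lsum u := sumE _ (scalar_ext_mul_linear_r u).
have Rsum u := sumE _ (scalar_ext_mul_linear_l u).
rewrite [x]scalar_ext_sum !Rsum Lsum -big_split; apply: eq_bigr => i _ /=.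
rewrite -scalerDr; congr (_ *: _).
rewrite [y]scalar_ext_sum !(Lsum, Rsum) -big_split; apply: eq_bigr => j _ /=.
rewrite -scalerDr; congr (_ *: _).
rewrite [z]scalar_ext_sum !Lsum -big_split; apply: eq_bigr => k _ /=.
rewrite -scalerDr; congr (_ *: _).
by rewrite -!scalar_ext_in_mul -scalar_ext_inD lmul_leibniz.
Qed.

HB.instance Definition _ := Vector_isLeibniz.Build K NK
  scalar_ext_mul_linear_l scalar_ext_mul_linear_r scalar_ext_mul_leibniz.

End ScalarExtension.

(* Column convention: column j holds the coordinates of f e_j. *)
Definition matrix_in_basis (K : fieldType) (V : vectType K) n
    (e : n.-tuple V) (f : V -> V) : 'M[K]_n :=
  \matrix_(i, j) coord e i (f e`_j).

(* is_trig_mx is lower triangularity. *)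
Definition is_upper_trig_mx (K : fieldType) n (M : 'M[K]_n) : bool :=
  is_trig_mx M^T.

(* To be used with iota : F -> K an algebraic closure of F. *)
Definition triangulable (F K : fieldType) (iota : {rmorphism F -> K})
    (N : leibnizType F) : Prop :=
  let NK : leibnizType K := scalar_ext N iota in
  exists2 e : (\dim {:NK}).-tuple NK, basis_of {:NK} e &
    forall x : NK,
      is_upper_trig_mx (matrix_in_basis e (fun a => x ** a)) /\
      is_upper_trig_mx (matrix_in_basis e (fun a => a ** x)).

Definition recognizable (F : fieldType) (n : nat)
    (C P : leibnizType F -> Prop) : Prop :=
  forall A : leibnizType F, C A ->
    (forall (X : n.-tuple A) (S : subalgebra A),
       is_generated_by S X -> P (subalg_of S)) ->
    P A.

(* Main.v *)
Require Import Defs.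
From HB Require Import structures.
From mathcomp Require Import all_boot all_algebra.
From Stdlib Require Import Classical.

Set Implicit Arguments.
Unset Strict Implicit.
Unset Printing Implicit Defensive.

Import GRing.Theory.
Local Open Scope ring_scope.

(** Over an algebraically closed field, the multiplication operators of an
    algebra are simultaneously triangular in a basis adapted to a flag of
    two-sided ideals, and such a flag exists as soon as left multiplications by
    A ** A act nilpotently: on a chief factor J / I they then act by 0, so the
    left multiplications commute there, each is a scalar, and the right
    multiplications are either 0 or the opposites of the left ones
    (chief_factor_bimodule); every line of J / I is an ideal
    (exists_triangulating_basis). Nilpotency of the action of A ** A, unlike
    triangularity, passes from F to K by mere bilinearity
    (scalar_ext_left_nilpotent), so that the whole difficulty is over F.

    In a triangulable algebra a product u ** v acts on the left by a commutator
    of triangular matrices, hence nilpotently. So the hypothesis on the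
    subalgebras generated by two elements gives, for p = x ** y, that
    iter N (lmul p) kills x and y (product_engel). It says nothing directly on
    the action of p on a chief factor J / I of A, which a priori involves a third
    element. The idea is to evaluate the identity at x + b or y + b with b in J:
    J / I being abelian, the variation with b is linear in b, and if the
    unperturbed vector and its images under p annihilate J / I, that variation is
    iter N (lmul p) applied to an explicit noncommutative polynomial in x, y
    acting on b (iter_lmul_perturb).

    Let C = D ** D be a term of the derived series such that C ** C annihilates
    J / I; the aim is that C annihilates it too. When J ** A lies in I, the
    variation is b itself and all products are nilpotent on J / I
    (antisym_nilpotent). Otherwise, write X, Y, Z, P for the actions on J / I of
    x, y, c in C and the product p under consideration.
    - For p = x ** c, perturbing x, then c, gives P^N Z^2 = 0 and
      P^N (P - Z X) = 0 where P commutes with Z; hence P^(N+1) Z = 0 and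
      P^(N+2) = 0 (sym_nilpotent_mul_abelian). These operators commute with each
      other, so they vanish on J / I, which is irreducible: the action of C is
      central.
    - For p = x ** y in C, perturbing x gives P^N (P + X Y) = 0 where
      P = X Y - Y X is central; comparing the products of this relation by X on
      the left and on the right yields P^(N+1) X = 0, whence P^(N+2) = 0
      (sym_nilpotent_mul). Again C is spanned by commuting nilpotent operators,
      so it annihilates J / I.
    Solvability starts this descent along the derived series, which ends with
    A ** A. No division occurs, so the characteristic is arbitrary. *)

(** * Extremal choices and subspaces given by predicates *)

Lemma exists_minimizer (T : Type) (P : T -> Prop) (f : T -> nat) t0 :
  P t0 -> exists2 t, P t & forall s, P s -> (f t <= f s)%N.
Proof.
move: {2}(f t0) (leqnn (f t0)) => n; elim: n t0 => [|n IHn] t0 le_n Pt0.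
  by exists t0 => // s _; apply: leq_trans le_n _.
have [[s [Ps lt_s]] | noS] := classic (exists s, P s /\ (f s < f t0)%N).
  by apply: (IHn s) => //; rewrite -ltnS (leq_trans lt_s).
exists t0 => // s Ps; rewrite leqNgt; apply/negP => lt_s.
by case: noS; exists s.
Qed.

Section Subspaces.
Variables (F : fieldType) (V : vectType F).
Implicit Types (P : V -> Prop) (U : {vspace V}).

Lemma exists_maxdim_vspace (P : {vspace V} -> Prop) U0 :
  P U0 -> exists2 U, P U & forall W, P W -> (\dim W <= \dim U)%N.
Proof.
move=> PU0; pose codim (U : {vspace V}) := (\dim {:V} - \dim U)%N.
have [U PU minU] := exists_minimizer codim PU0.
exists U => // W /minU; rewrite leq_sub2lE //; exact: dimvS (subvf _).
Qed.

Definition subspace_pred P := P 0 /\ forall a u v, P u -> P v -> P (a *: u + v).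

(** A subspace contained in P and of maximal dimension contains every vector
    satisfying P, as it could otherwise be enlarged by a line. *)
Lemma subspace_comprehension P :
  subspace_pred P -> exists U, forall u, u \in U <-> P u.
Proof.
move=> [P0 Plin]; pose inP (U : {vspace V}) := forall u, u \in U -> P u.
have inP0: inP 0%VS by move=> u /[!memv0] /eqP->.
have [U PU maxU] := exists_maxdim_vspace inP0.
exists U => u; split=> [/PU // | Pu]; apply: contraT => u_notin.
have /maxU: inP (U + <[u]>)%VS.
  move=> _ /memv_addP[v vU [_ /vlineP[a ->] ->]].
  by rewrite addrC; apply: Plin => //; apply: PU.
rewrite leqNgt => /negP[]; rewrite (ltn_leqif (dimv_leqif_sup (addvSl _ _))).
rewrite subv_add subvv /=; apply: contra u_notin => /subvP; apply.
exact: memv_line.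
Qed.

Lemma span_ind P (X : seq V) :
  subspace_pred P -> {in X, forall u, P u} -> {in <<X>>%VS, forall u, P u}.
Proof.
move=> /subspace_comprehension[U defU] XP u.
have /subvP sXU: (<<X>> <= U)%VS by apply/span_subvP=> v /XP/defU.
by move/sXU/defU.
Qed.

End Subspaces.

(** * Products and ideals in Leibniz algebras *)

Section LeibnizTheory.
Variables (F : fieldType) (A : leibnizType F).
Implicit Types (x y z u v c j : A) (I J U W : {vspace A}).

Lemma lmulDl x y z : (x + y) ** z = x ** z + y ** z.
Proof. exact: (linearD (rmul z)). Qed.
Lemma lmulBl x y z : (x - y) ** z = x ** z - y ** z.
Proof. exact: (linearB (rmul z)). Qed.
Lemma lmulZl a x z : (a *: x) ** z = a *: (x ** z).
Proof. exact: (linearZ_LR (rmul z)). Qed.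
Lemma lmul0l z : 0 ** z = 0.
Proof. exact: (linear0 (rmul z)). Qed.
Lemma lmulDr x y z : x ** (y + z) = x ** y + x ** z.
Proof. exact: linearD. Qed.
Lemma lmulBr x y z : x ** (y - z) = x ** y - x ** z.
Proof. exact: linearB. Qed.
Lemma lmulNr x y : x ** (- y) = - (x ** y).
Proof. exact: linearN. Qed.
Lemma lmulZr a x z : x ** (a *: z) = a *: (x ** z).
Proof. exact: linearZ_LR. Qed.
Lemma lmul0r x : x ** 0 = 0.
Proof. exact: linear0. Qed.

Lemma lmul_prod x y z : (x ** y) ** z = x ** (y ** z) - y ** (x ** z).
Proof. by rewrite lmul_leibniz addrK. Qed.

Lemma mem_sprod U W u v : u \in U -> v \in W -> u ** v \in sprod U W.
Proof. by move=> uU vW; apply: (elimT (sprod_subP U W _) (subvv _)). Qed.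

Lemma sprodS U U' W W' :
  (U <= U')%VS -> (W <= W')%VS -> (sprod U W <= sprod U' W')%VS.
Proof.
move=> /subvP sU /subvP sW; apply/sprod_subP => u v uU vW.
by apply: mem_sprod; [apply: sU | apply: sW].
Qed.

Lemma sprod_ind U W (P : A -> Prop) :
  subspace_pred P -> {in U & W, forall u v, P (u ** v)} ->
  {in sprod U W, forall u, P u}.
Proof.
move=> Psub UWP; apply: span_ind => // _ /allpairsP[[u w] [uU wW ->]].
by apply: UWP; apply: vbasis_mem.
Qed.

Definition left_ideal U := forall x u, u \in U -> x ** u \in U.
Definition ideal U := forall x u, u \in U -> x ** u \in U /\ u ** x \in U.

(** Left multiplications are derivations. Right ones are not: (u ** w) ** x
    involves w ** (u ** x), so products of two-sided ideals are only controlled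
    on the left. *)
Lemma left_ideal_sprod U W :
  left_ideal U -> left_ideal W -> left_ideal (sprod U W).
Proof.
move=> idU idW x; apply: sprod_ind => [|u w uU wW].
  split=> [|a u v xu xv]; first by rewrite lmul0r mem0v.
  by rewrite lmulDr lmulZr memvD ?memvZ.
rewrite lmul_leibniz; apply: memvD; apply: mem_sprod => //.
  exact: idU.
exact: idW.
Qed.

Lemma left_ideal_full : left_ideal fullv.
Proof. by move=> x u _; apply: memvf. Qed.

Lemma left_ideal_derived i : left_ideal (derived_series A i).
Proof.
elim: i => [|i IHi]; [exact: left_ideal_full | exact: left_ideal_sprod].
Qed.

Lemma ideal_addv U W : ideal U -> ideal W -> ideal (U + W)%VS.
Proof.
move=> idU idW x _ /memv_addP[u uU [w wW ->]].
have [xu ux] := idU x u uU; have [xw wx] := idW x w wW.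
by rewrite lmulDl lmulDr !memv_add.
Qed.

Lemma ideal_sqr U : ideal U -> ideal (sprod U U).
Proof.
move=> idU x u uUU.
have lidU: left_ideal U by move=> y v /idU-/(_ y)[].
split; first exact: left_ideal_sprod uUU.
move: u uUU; apply: sprod_ind => [|u v uU vU].
  split=> [|a u v ux vx]; first by rewrite lmul0l mem0v.
  by rewrite lmulDl lmulZl memvD ?memvZ.
have [_ ux] := idU x u uU; have [_ vx] := idU x v vU.
by rewrite lmul_prod memvB ?mem_sprod.
Qed.

Lemma iter_lmulD n p u v :
  iter n (lmul p) (u + v) = iter n (lmul p) u + iter n (lmul p) v.
Proof. by elim: n => //= n ->; rewrite lmulDr. Qed.

Lemma iter_lmulB n p u v :
  iter n (lmul p) (u - v) = iter n (lmul p) u - iter n (lmul p) v.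
Proof. by elim: n => //= n ->; rewrite lmulBr. Qed.

Lemma iter_lmul_ideal n p U u :
  left_ideal U -> u \in U -> iter n (lmul p) u \in U.
Proof. by move=> idU uU; elim: n => //= n /idU. Qed.

(** This much of the triangulability of the subalgebra generated by x and y is
    all that the argument uses; being an identity in two variables, it can be
    evaluated at perturbed pairs such as (x + b, y). *)
Definition product_engel N := forall x y,
  iter N (lmul (x ** y)) x = 0 /\ iter N (lmul (x ** y)) y = 0.

(** This is the nilpotency of A ** A, in the form that the existence of a
    common flag needs: a bounded number of left multiplications by elements of
    A ** A vanishes on the whole of A. *)
Definition sqr_left_nilpotent : Prop :=
  exists m, iter m (sprod (sprod fullv fullv)) fullv = 0%VS :> {vspace A}.

(** * Chief factors *)

Definition chief_factor I J :=
  [/\ ideal I, ideal J, (I <= J)%VS, ~~ (J <= I)%VS &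
      forall U, ideal U -> (I <= U)%VS -> (U <= J)%VS -> (U <= I)%VS \/ (J <= U)%VS].

Lemma exists_chief_factor I :
  ideal I -> ~~ (fullv <= I)%VS -> exists J, chief_factor I J.
Proof.
move=> idI nIA; pose P U := [/\ ideal U, (I <= U)%VS & ~~ (U <= I)%VS].
have PA: P fullv by split; rewrite ?subvf // => x u _; rewrite !memvf.
have [J [idJ sIJ nJI] minJ] := exists_minimizer (fun U => \dim U) PA.
exists J; split=> // U idU sIU sUJ; have [sUI | nUI] := boolP (U <= I)%VS.
  by left.
right; rewrite -(dimv_leqif_sup sUJ) eqn_leq dimvS //=; exact: minJ.
Qed.

Section ChiefFactor.
Variables (I J : {vspace A}) (chiefIJ : chief_factor I J).

Let idI : ideal I. Proof. by case: chiefIJ. Qed.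
Let idJ : ideal J. Proof. by case: chiefIJ. Qed.
Let sIJ u : u \in I -> u \in J. Proof. by case: chiefIJ => _ _ /subvP/(_ u). Qed.
Let Il x u : u \in I -> x ** u \in I. Proof. by move/idI => /(_ x)[]. Qed.
Let Ir x u : u \in I -> u ** x \in I. Proof. by move/idI => /(_ x)[]. Qed.
Let Jl x u : u \in J -> x ** u \in J. Proof. by move/idJ => /(_ x)[]. Qed.
Let Jr x u : u \in J -> u ** x \in J. Proof. by move/idJ => /(_ x)[]. Qed.

Lemma chief_factor_ideal_ind (P : A -> Prop) :
    subspace_pred P -> {in I, forall u, P u} ->
    (forall x, {in J, forall u, P u -> P (x ** u) /\ P (u ** x)}) ->
  (exists2 j, P j & j \in J /\ j \notin I) -> {in J, forall u, P u}.
Proof.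
move=> [P0 Plin] PI Pid [j Pj [jJ jI]].
have [|U defU] := @subspace_comprehension _ _ (fun u => u \in J /\ P u).
  split=> [|a u v [uJ Pu] [vJ Pv]]; first by rewrite mem0v.
  by split; [rewrite memvD ?memvZ | apply: Plin].
have [_ _ _ _ minJ] := chiefIJ; have idU: ideal U.
  move=> x u /defU[uJ Pu]; have [Pxu Pux] := Pid x u uJ Pu.
  by split; apply/defU; split=> //; [exact: Jl | exact: Jr].
have sIU: (I <= U)%VS.
  by apply/subvP=> u uI; apply/defU; split; [apply: sIJ | apply: PI].
have sUJ: (U <= J)%VS by apply/subvP=> u /defU[].
have [/subvP/(_ j) UI | /subvP JU] := minJ U idU sIU sUJ.
  by case/negP: jI; apply/UI/defU.
by move=> u /JU/defU[].
Qed.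

Lemma chief_factor_exists : exists2 j, j \in J & j \notin I.
Proof.
by have [_ _ _ /subvPn[j jJ jI] _] := chiefIJ; exists j.
Qed.

(** The elements of J that send A into I on their left form an ideal, hence they
    are I or J. They contain all j ** x + x ** j, by the Leibniz identity, so if
    they reduce to I then right multiplications are opposite to left ones. *)
Lemma chief_factor_bimodule :
  (forall x, {in J, forall j, j ** x \in I}) \/
  (forall x, {in J, forall j, j ** x + x ** j \in I}).
Proof.
pose P j := forall x, j ** x \in I.
have P_subspace: subspace_pred P.
  split=> [x|a u v Pu Pv x]; first by rewrite lmul0l mem0v.
  by rewrite lmulDl lmulZl memvD ?memvZ.
have [exP | noP] := classic (exists2 j, P j & j \in J /\ j \notin I).
  left=> x j jJ; move: j jJ x; apply: chief_factor_ideal_ind exP => // [u uI x|].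
    exact: Ir.
  move=> x u uJ Pu; split=> y; last exact/Ir/Pu.
  by rewrite lmul_prod; apply: memvB; [apply/Il/Pu | apply: Pu].
right=> x j jJ; apply: contraT => notI; case: noP.
exists (j ** x + x ** j); last by rewrite memvD ?(Jl _ jJ) ?(Jr _ jJ).
move=> y; rewrite lmulDl !lmul_prod.
by rewrite addrA subrK subrr mem0v.
Qed.

(** By chief_factor_bimodule, stability under right multiplications comes for
    free. *)
Lemma chief_factor_ind (P : A -> Prop) :
    subspace_pred P -> {in I, forall u, P u} ->
    (forall x, {in J, forall u, P u -> P (x ** u)}) ->
  (exists2 j, P j & j \in J /\ j \notin I) -> {in J, forall u, P u}.
Proof.
move=> Psub PI Pl; apply: chief_factor_ideal_ind => // x u uJ Pu; split; first exact: Pl.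
have [alt | sym] := chief_factor_bimodule; first exact/PI/alt.
have [_ Plin] := Psub; have:= Plin (-1) _ _ (Pl x u uJ Pu) (PI _ (sym x u uJ)).
by rewrite scaleN1r addrCA addNr addr0.
Qed.

(** If J were J ** J modulo I, it would lie in every term of the derived series
    modulo I. *)
Lemma chief_factor_abelian :
  solvable_leibniz A -> {in J &, forall j j', j ** j' \in I}.
Proof.
move=> [n An0]; apply/sprod_subP; have [_ _ _ nJI minJ] := chiefIJ.
have idJJI: ideal (sprod J J + I)%VS by apply: ideal_addv => //; apply: ideal_sqr.
have sJJIJ: (sprod J J + I <= J)%VS.
  rewrite subv_add; apply/andP; split; last exact/subvP.
  by apply/sprod_subP => u v _; apply: Jl.
have [|sJJI] := minJ _ idJJI (addvSr _ _) sJJIJ.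
  by rewrite subv_add => /andP[].
case/negP: nJI.
suff: (J <= derived_series A n + I)%VS by rewrite An0 add0v.
elim: n {An0} => [|n IHn]; first by rewrite /= addvC (subv_trans (subvf _)) ?addvSr.
apply: subv_trans sJJI _; rewrite subv_add addvSr andbT.
apply/sprod_subP=> j j' /(subvP IHn)/memv_addP[u uD [i iI ->]].
move=> /(subvP IHn)/memv_addP[v vD [k kI ->]].
rewrite lmulDl lmulDr -addrA memv_add ?mem_sprod //.
by apply: memvD; [apply: Il | apply: Ir].
Qed.

Definition annihilates t := {in J, forall j, t ** j \in I}.

Lemma annihilates_subspace : subspace_pred annihilates.
Proof.
split=> [j _|a s t sJ tJ j jJ]; first by rewrite lmul0l mem0v.
by rewrite lmulDl lmulZl memvD ?memvZ ?sJ ?tJ.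
Qed.

Lemma annihilates_mulr s t : annihilates t -> annihilates (s ** t).
Proof.
by move=> tJ j jJ; rewrite lmul_prod; apply: memvB; [apply/Il/tJ | apply/tJ/Jl].
Qed.

(** The left actions of s ** t and t ** s are opposite commutators. *)
Lemma annihilates_mulC s t : annihilates (s ** t) -> annihilates (t ** s).
Proof.
move=> stJ j jJ; have:= stJ j jJ.
by rewrite lmul_prod -memvN opprB -lmul_prod.
Qed.

(** Commuting nilpotent operators have a common kernel vector in J / I. The
    vectors killed by the left ideal they span form a sub-bimodule of J / I,
    which is therefore everything. *)
Lemma annihilates_sprod U W :
    left_ideal (sprod U W) ->
    {in sprod U W &, forall s t, annihilates (s ** t)} ->
    {in U & W, forall u w, {in J, forall j, exists n, iter n (lmul (u ** w)) j \in I}} ->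
  {in sprod U W, forall t, annihilates t}.
Proof.
move=> idE EE nilE; set E := sprod U W in idE EE *.
have comE s t j : s \in E -> t \in E -> j \in J -> s ** (t ** j) - t ** (s ** j) \in I.
  by move=> sE tE jJ; rewrite -lmul_prod EE.
pose P j := {in E, forall t, t ** j \in I}.
suff PJ: {in J, forall j, P j} by move=> t tE j /PJ; apply.
apply: chief_factor_ind.
- split=> [t|a u v Pu Pv t tE]; first by rewrite lmul0r mem0v.
  by rewrite lmulDr lmulZr memvD ?memvZ ?Pu ?Pv.
- by move=> u uI t _; apply: Il.
(* t ** (x ** u) = x ** (t ** u) - (x ** t) ** u, and x ** t is in E. *)
- move=> x u uJ Pu t tE; have:= memvB (Il x (Pu _ tE)) (Pu _ (idE x _ tE)).
  by rewrite lmul_prod opprB addrC subrK.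
have{nilE} [s defE nilE]: exists2 s : seq A, E = <<s>>%VS &
    {in s, forall t, {in J, forall j, exists n, iter n (lmul t) j \in I}}.
  exists [seq u ** w | u <- vbasis U, w <- vbasis W] => //.
  move=> t /allpairsP[[u w] /= [uU wW ->]].
  by apply: nilE; apply: vbasis_mem.
have sE: {subset s <= E} by move=> t ts; rewrite defE memv_span.
suff [j js [jJ jI]]: exists2 j, {in s, forall t, t ** j \in I} & j \in J /\ j \notin I.
  exists j => // t; rewrite defE => /(@coord_span _ _ _ (in_tuple s)) ->.
  rewrite -/(rmul _ _) linear_sum memv_suml // => i _.
  rewrite linearZ memvZ //=; apply: js; exact: mem_nth.
elim: s {defE} nilE sE => [|t s IHs] nilE sE.
  by have [j jJ jI] := chief_factor_exists; exists j.
case: IHs => [u us | u us | j js [jJ jI]].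
- by apply: nilE; rewrite inE us orbT.
- by apply: sE; rewrite inE us orbT.
have tE: t \in E by rewrite sE ?mem_head.
have [|n] := nilE t _ j jJ; first exact: mem_head.
elim: n j js jJ jI => [|n IHn] j js jJ jI; first by rewrite /= (negPf jI).
have [tjI _ | tjI] := boolP (t ** j \in I); last first.
  rewrite iterSr; apply: IHn => //; last exact: Jl.
  move=> u us; have uE: u \in E by rewrite sE // inE us orbT.
  by have:= memvD (comE u t j uE tE jJ) (Il t (js u us)); rewrite subrK.
by exists j => // u; rewrite inE => /predU1P[-> // | /js].
Qed.


(** * Perturbation of the Engel identity *)

Lemma mem_congr u v : u - v \in I -> (u \in I) = (v \in I).
Proof. by move=> uvI; rewrite -(subrK v u) rpredDl. Qed.

Lemma iter_lmul_congr n p u v :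
  u - v \in I -> iter n (lmul p) u - iter n (lmul p) v \in I.
Proof. by move=> uvI; rewrite -iter_lmulB iter_lmul_ideal // => x w; apply: Il. Qed.

Lemma iter_lmul_comm n p t j : annihilates (p ** t) -> j \in J ->
  iter n (lmul p) (t ** j) - t ** iter n (lmul p) j \in I.
Proof.
move=> pt jJ; elim: n => [|n IHn]; first by rewrite subrr mem0v.
have nJ: iter n (lmul p) j \in J by apply: iter_lmul_ideal => // x w; apply: Jl.
have:= memvD (Il p IHn) (pt _ nJ).
by rewrite lmulBr lmul_prod addrA subrK.
Qed.

(** With q = p' - p, the terms of iter n (lmul (p + q)) (u + (u' - u)) that
    involve q lie in I: either q meets an iterate of u, or it meets an element
    of J. So the variation of the iterate is the iterate of the variation. *)
Lemma iter_lmul_perturb n p p' u u' :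
    {in J &, forall j j', j ** j' \in I} ->
    p' - p \in J -> u' - u \in J ->
    (forall k, (p' - p) ** iter k (lmul p) u \in I) ->
    iter n (lmul p) u = 0 -> iter n (lmul p') u' = 0 ->
  iter n (lmul p) (u' - u) \in I.
Proof.
move=> JJ; set q := p' - p; set v := u' - u => qJ vJ qu pu0 pu'0.
have vnJ k : iter k (lmul p) v \in J by apply: iter_lmul_ideal => // x w; apply: Jl.
suff [w wI]: exists2 w, w \in I &
    iter n (lmul p') u' = iter n (lmul p) u + (iter n (lmul p) v + w).
  by rewrite pu0 pu'0 add0r => /esym/eqP; rewrite addr_eq0 => /eqP->; rewrite memvN.
elim: n {pu0 pu'0} => [|n [w wI IHn]].
  by exists 0; rewrite ?mem0v //= addr0 addrC subrK.
have wJ := sIJ wI; pose r := q ** (iter n (lmul p) v + w).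
exists (p ** w + (q ** iter n (lmul p) u + r)).
  apply: memvD; [exact: Il | apply: memvD; [exact: qu | apply: JJ => //]].
  exact: memvD.
rewrite !iterS IHn -[p'](subrK p) -/q addrC lmulDl !lmulDr /r lmulDr.
by rewrite -!addrA.
Qed.

Section Engel.
Variable N : nat.
Hypothesis engelA : product_engel N.
Hypothesis JJ : {in J &, forall j j', j ** j' \in I}.

Let engel_mull x y : iter N (lmul (x ** y)) ((x ** y) ** x) = 0.
Proof. by rewrite -iterSr iterS; have [-> _] := engelA x y; rewrite lmul0r. Qed.

Let engel_mulr x y : iter N (lmul (x ** y)) ((x ** y) ** y) = 0.
Proof. by rewrite -iterSr iterS; have [_ ->] := engelA x y; rewrite lmul0r. Qed.

(** Here all terms with a factor b on the left vanish, so that comparing the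
    pairs (x, y) and (x, y + b) isolates b itself. *)
Lemma antisym_nilpotent x y :
    (forall z, {in J, forall j, j ** z \in I}) ->
  {in J, forall j, iter N (lmul (x ** y)) j \in I}.
Proof.
move=> antisym b bJ; have def_b : (y + b) - y = b by rewrite addrC addKr.
rewrite -[X in iter _ _ X]def_b.
have qJ : x ** (y + b) - x ** y \in J by rewrite -lmulBr def_b Jl.
apply: (@iter_lmul_perturb _ _ (x ** (y + b))) => //.
- by rewrite def_b.
- by move=> k; apply: antisym.
- by have [] := engelA x y.
by have [] := engelA x (y + b).
Qed.

(** * Nilpotency of the products on symmetric chief factors *)

Section Symmetric.
Hypothesis sym : forall z, {in J, forall j, j ** z + z ** j \in I}.

Let anni q t : annihilates t -> q \in J -> q ** t \in I.
Proof. by move=> tJ qJ; rewrite (mem_congr (v := - (t ** q))) ?memvN ?tJ ?opprK ?sym. Qed.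

Let anni_iter p u k : annihilates u -> annihilates (iter k (lmul p) u).
Proof. by move=> uJ; elim: k => //= k; apply: annihilates_mulr. Qed.

(** The pairs (x + b, c) and (x, c + b) give P^N Z^2 = 0 and P^N (P - Z X) = 0
    on J / I, where P = [X, Z]; since P commutes with Z, multiplying the second
    relation by Z on the left gives P^(N+1) Z = 0, and then by P gives
    P^(N+2) = 0. *)
Lemma sym_nilpotent_mul_abelian C x c :
    left_ideal C -> {in C &, forall s t, annihilates (s ** t)} -> c \in C ->
  {in J, forall b, iter N.+2 (lmul (x ** c)) b \in I}.
Proof.
move=> idC CC cC; set p := x ** c; have pC: p \in C by apply: idC.
have first_word b : b \in J -> iter N (lmul p) (c ** (c ** b)) \in I.
  move=> bJ; have p'p: (x + b) ** c - p = b ** c by rewrite lmulDl addrC addKr.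
  have u'u: ((x + b) ** c) ** c - p ** c = (b ** c) ** c by rewrite -lmulBl p'p.
  rewrite (mem_congr (v := iter N (lmul p) ((b ** c) ** c))); last first.
    apply: iter_lmul_congr.
    rewrite (_ : _ - _ = c ** (b ** c + c ** b) - ((b ** c) ** c + c ** (b ** c))).
      by rewrite memvB ?(Il _ (sym _ bJ)) ?sym ?Jr.
    by rewrite lmulDr [(b ** c) ** c + _]addrC opprD addrACA subrr add0r.
  rewrite -u'u; apply: (@iter_lmul_perturb _ _ ((x + b) ** c)) => //; rewrite ?p'p ?u'u.
  - exact: Jr.
  - exact/Jr/Jr.
  - by move=> k; apply: anni; [apply: anni_iter; apply: CC | apply: Jr].
  exact: (engel_mulr x c).
have second_word b : b \in J -> iter N (lmul p) (p ** b - c ** (x ** b)) \in I.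
  move=> bJ; have p'p: x ** (c + b) - p = x ** b by rewrite -lmulBr addrC addKr.
  have u'u: (x ** (c + b)) ** (c + b) - p ** c = p ** b + (x ** b) ** (c + b).
    by rewrite -[x ** (c + b)](subrK p) p'p lmulDl [p ** _]lmulDr addrCA addrAC subrr add0r addrC.
  rewrite (mem_congr (v := iter N (lmul p) (p ** b + (x ** b) ** (c + b)))).
    rewrite -u'u; apply: (@iter_lmul_perturb _ _ (x ** (c + b))) => //; rewrite ?p'p ?u'u.
    - exact: Jl.
    - by apply: memvD; [exact: Jl | exact/Jr/Jl].
    - by move=> k; apply: anni; [apply: anni_iter; apply: CC | apply: Jl].
    exact: (engel_mulr x c).
  apply: iter_lmul_congr.
  rewrite (_ : _ - _ = - ((x ** b) ** c + c ** (x ** b)) - (x ** b) ** b).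
    by rewrite memvB ?memvN ?sym ?JJ ?Jl.
  by rewrite opprD addrACA subrr add0r lmulDr opprD addrA -opprD [c ** _ + _]addrC.
have mul_c b : b \in J -> iter N.+1 (lmul p) (c ** b) \in I.
  move=> bJ; rewrite (mem_congr (v := c ** iter N.+1 (lmul p) b)); last first.
    by apply: iter_lmul_comm => //; apply: CC.
  have:= Il c (second_word b bJ); rewrite iter_lmulB lmulBr -iterSr => /mem_congr->.
  rewrite -(@mem_congr (iter N (lmul p) (c ** (c ** (x ** b))))).
    exact/first_word/Jl.
  by apply: iter_lmul_comm; [apply: CC | apply/Jl/Jl].
move=> b bJ; have:= Il p (second_word b bJ).
rewrite iter_lmulB lmulBr -iterSr => /mem_congr ->.
exact/mul_c/Jl.
Qed.

(** The pair (x + b, y) gives P^N (P + X Y) = 0 on J / I. Multiplying by X on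
    the left and on the right and subtracting gives P^N X (X Y - Y X) = 0, that
    is P^(N+1) X = 0; multiplying by P then gives P^(N+2) = 0. *)
Lemma sym_nilpotent_mul x y :
    (forall z, annihilates (z ** (x ** y))) ->
  {in J, forall b, iter N.+2 (lmul (x ** y)) b \in I}.
Proof.
set p := x ** y => p_central.
have pr z : annihilates (p ** z) by apply/annihilates_mulC/p_central.
have word b : b \in J -> iter N (lmul p) (p ** b + x ** (y ** b)) \in I.
  move=> bJ; have p'p: (x + b) ** y - p = b ** y by rewrite -lmulBl addrC addKr.
  have u'u: ((x + b) ** y) ** (x + b) - p ** x = p ** b + (b ** y) ** (x + b).
    by rewrite -[(x + b) ** y](subrK p) p'p lmulDl [p ** _]lmulDr addrCA addrAC subrr add0r addrC.
  rewrite (mem_congr (v := iter N (lmul p) (p ** b + (b ** y) ** (x + b)))).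
    rewrite -u'u; apply: (@iter_lmul_perturb _ _ ((x + b) ** y)) => //; rewrite ?p'p ?u'u.
    - exact: Jr.
    - by apply: memvD; [exact: Jl | exact/Jr/Jr].
    - by move=> k; apply: anni; [apply: anni_iter; apply: pr | apply: Jr].
    exact: (engel_mull x y).
  apply: iter_lmul_congr.
  rewrite (_ : _ - _ = x ** (b ** y + y ** b) - ((b ** y) ** x + x ** (b ** y))
                       - (b ** y) ** b).
    apply: memvB; last by apply: JJ => //; apply: Jr.
    by apply: memvB; [apply/Il/sym | apply/sym/Jr].
  rewrite opprD addrACA subrr add0r !lmulDr opprD addrA; congr (_ - _).
  by rewrite [(b ** y) ** x + _]addrC opprD addrACA subrr add0r.
have mul_x b : b \in J -> iter N.+1 (lmul p) (x ** b) \in I.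
  move=> bJ; rewrite iterSr (mem_congr (v := iter N (lmul p) (x ** (p ** b)))); last first.
    by apply: iter_lmul_congr; rewrite -lmul_prod; apply: pr.
  have xw : iter N (lmul p) (x ** (p ** b + x ** (y ** b))) \in I.
    rewrite (@mem_congr _ (x ** iter N (lmul p) (p ** b + x ** (y ** b)))).
      exact/Il/word.
    by apply: iter_lmul_comm; rewrite ?memvD ?(Jl _ bJ) ?(Jl _ (Jl _ bJ)).
  have:= memvB xw (word _ (Jl x bJ)); rewrite -iter_lmulB.
  set w := (X in iter N (lmul p) X) => wI.
  rewrite (@mem_congr _ (iter N (lmul p) w)) //; apply: iter_lmul_congr.
  have -> : x ** (p ** b) - w = (p ** x) ** b; last exact: pr.
  rewrite /w lmulDr -addrA opprD addrA subrr add0r opprB [p ** (x ** b) + _]addrC.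
  by rewrite addrAC -lmulBr -opprB lmulNr -lmul_prod [RHS]lmul_prod addrC.
move=> b bJ; have:= Il p (word b bJ).
rewrite iter_lmulD lmulDr -iterSr -[X in _ + X]opprK => /mem_congr ->.
by rewrite memvN; apply/mul_x/Jl.
Qed.

End Symmetric.

(** * Descent along the derived series *)

(** The products x ** c lie in C, so they commute on J / I. *)
Lemma annihilates_left_mul C :
    left_ideal C -> {in C &, forall s t, annihilates (s ** t)} ->
  {in C, forall c x, annihilates (x ** c)}.
Proof.
move=> idC CC c cC x; have idAC := left_ideal_sprod left_ideal_full idC.
have /subvP sACC: (sprod fullv C <= C)%VS by apply/sprod_subP=> y d _; apply: idC.
apply: (annihilates_sprod idAC); last by rewrite mem_sprod ?memvf.
  by move=> s t /sACC sC /sACC; apply: CC.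
move=> y d _ dC j jJ; have [antisym | sym] := chief_factor_bimodule.
  by exists N; apply: antisym_nilpotent.
by exists N.+2; apply: (sym_nilpotent_mul_abelian sym _ idC).
Qed.

Lemma annihilates_sqr D : left_ideal D ->
    {in sprod D D &, forall s t, annihilates (s ** t)} ->
  {in sprod D D, forall t, annihilates t}.
Proof.
move=> idD CC; have idC := left_ideal_sprod idD idD.
apply: annihilates_sprod => // x y xD yD j jJ.
have [antisym | sym] := chief_factor_bimodule.
  by exists N; apply: antisym_nilpotent.
exists N.+2; apply: sym_nilpotent_mul => // z.
by apply: (annihilates_left_mul idC CC); apply: mem_sprod.
Qed.

(** Descent along the derived series, from its last term down to A ** A. *)
Lemma annihilates_mul x y : solvable_leibniz A -> annihilates (x ** y).
Proof.
case=> n An0; suff ann1: {in derived_series A 1, forall t, annihilates t}.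
  by apply: ann1; rewrite mem_sprod ?memvf.
(* The descent stops at index 1, so it must not start at index 0. *)
have: {in derived_series A n.+1, forall t, annihilates t}.
  have ->: derived_series A n.+1 = sprod 0%VS 0%VS by rewrite -An0.
  apply: sprod_ind; first exact: annihilates_subspace.
  move=> u v; rewrite memv0 => /eqP-> _ j _.
  by rewrite !lmul0l mem0v.
elim: n {An0} => // n IHn annn; apply: IHn; apply: annihilates_sqr => [|s t sD tD].
  exact: left_ideal_derived.
by apply: annn; apply: mem_sprod.
Qed.

End Engel.
End ChiefFactor.

(** An ideal of maximal dimension on which A ** A acts nilpotently is A, as any
    chief factor above it is annihilated by A ** A. *)
Lemma sqr_left_nilpotent_engel N :
  solvable_leibniz A -> product_engel N -> sqr_left_nilpotent.
Proof.
move=> solA engelA; pose low m := iter m (sprod (sprod (@fullv F A) fullv)).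
pose P I := ideal I /\ exists m, low m I = 0%VS.
have P0: P 0%VS.
  split; last by exists 0.
  by move=> x u /[!memv0] /eqP->; rewrite lmul0l lmul0r.
have [I [idI [m lowI]] maxI] := exists_maxdim_vspace P0.
have [sAI | nAI] := boolP (fullv <= I)%VS.
  by exists m; rewrite -lowI; congr iter; apply/eqP; rewrite eqEsubv sAI subvf.
have [J chiefIJ] := exists_chief_factor idI nAI; have [_ idJ sIJ nJI _] := chiefIJ.
have JJ := chief_factor_abelian chiefIJ solA.
suff /maxI: P J by rewrite leqNgt (ltn_leqif (dimv_leqif_sup sIJ)) nJI.
split=> //; exists m.+1; rewrite /low iterSr -/(low m _).
have sA2J: (sprod (sprod fullv fullv) J <= I)%VS.
  apply/sprod_subP=> s j + jJ; move: s; apply: sprod_ind => [|x y _ _].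
    split=> [|a u v uI vI]; first by rewrite lmul0l mem0v.
    by rewrite lmulDl lmulZl memvD ?memvZ.
  exact: (annihilates_mul chiefIJ engelA JJ).
apply/eqP; rewrite -subv0 -lowI; elim: (m) => //= k IHk; exact: sprodS.
Qed.

End LeibnizTheory.

(** * Triangulating bases over a closed field *)

Section Eigenvector.
Variables (K : closedFieldType) (V : vectType K) (f : {linear V -> V}).

(* The value of p(f) v when size p <= n; the common bound n avoids truncations
   that depend on p. *)
Let hev n (p : {poly K}) v := \sum_(i < n) p`_i *: iter i f v.

Let hevMX n (p : {poly K}) a v : (size p <= n)%N ->
  hev n.+1 (p * ('X - a%:P)) v = f (hev n.+1 p v) - a *: hev n.+1 p v.
Proof.
move=> le_pn; have cut: hev n.+1 p v = hev n p v.
  by rewrite /hev big_ord_recr /= nth_default // scale0r addr0.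
transitivity (\sum_(i < n.+1) (p * 'X)`_i *: iter i f v - a *: hev n.+1 p v).
  rewrite /hev scaler_sumr -sumrB; apply: eq_bigr => i _.
  by rewrite mulrBr coefB coefMC scalerBl scalerA [a * _]mulrC.
congr (_ - _); rewrite cut big_ord_recl coefMX scale0r add0r linear_sum.
by apply: eq_bigr => i _; rewrite coefMX linearZ.
Qed.

(** Take p of minimal size such that p(f) v lies in I, write p = q ('X - a), and
    let w be q(f) v. *)
Lemma eigenvector_mod (I J : {vspace V}) v :
    (forall u, u \in J -> f u \in J) -> v \in J -> v \notin I ->
  exists a w, [/\ w \in J, w \notin I & f w - a *: w \in I].
Proof.
move=> fJ vJ vI; set n := \dim {:V}.
pose P (p : {poly K}) := [/\ p != 0, (size p <= n.+1)%N & hev n.+1 p v \in I].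
have hevJ m p : hev m p v \in J.
  by apply: memv_suml => i _; rewrite memvZ //; elim: (i : nat) => //= k /fJ.
have [p0 P0] : exists p, P p.
  pose X := [tuple iter i f v | i < n.+1].
  have /freeP nfX: ~~ free X.
    apply/negP=> /eqP dimX; have:= dimvS (subvf <<X>>%VS).
    by rewrite dimX size_tuple ltnn.
  have [k k_dep] := not_all_ex_not _ _ nfX.
  have [Xk0 k_nz] := imply_to_and _ _ k_dep.
  exists (\poly_(i < n.+1) k (inord i)); split.
  - apply/eqP => /polyP p0; apply: k_nz => i; have:= p0 i.
    by rewrite coef_poly ltn_ord inord_val coef0.
  - exact: size_poly.
  rewrite (_ : hev _ _ _ = 0) ?mem0v // -[RHS]Xk0; apply: eq_bigr => i _.
  by rewrite coef_poly ltn_ord inord_val -tnth_nth tnth_mktuple.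
have [p [p_nz le_pn pI] minp] := exists_minimizer (fun p : {poly K} => size p) P0.
have [a /factor_theorem[q def_p]]: exists a, root p a.
  apply/closed_rootP; apply: contra vI => /eqP p1.
  have [c c_nz def_p] := size_poly1P _ (introT eqP p1).
  move: pI; rewrite def_p /hev big_ord_recl big1 => [|i _].
    by rewrite addr0 coefC eqxx => cvI; rewrite -[v](scalerK c_nz) memvZ.
  by rewrite coefC scale0r.
have q_nz: q != 0 by apply: contra p_nz => /eqP q0; rewrite def_p q0 mul0r.
have size_p: size p = (size q).+1.
  by rewrite def_p size_Mmonic ?monicXsubC // size_XsubC addn2.
have le_qn: (size q <= n)%N by rewrite -ltnS -size_p.
exists a, (hev n.+1 q v); split => //; last by rewrite -hevMX -?def_p.
apply/negP=> qI; have:= minp q; rewrite size_p ltnn => /(_ _)/negP; apply=> //.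
by split=> //; apply: leqW.
Qed.

End Eigenvector.

Section Flag.
Variables (F : fieldType) (A : leibnizType F).
Implicit Types (I J U W : {vspace A}).

(** Going down the series J, (A ** A) ** J, ..., the last term not contained in I
    has elements outside I that A ** A sends into I; such elements form a
    sub-bimodule of J / I. *)
Lemma annihilates_of_nilpotent I J :
    chief_factor I J -> sqr_left_nilpotent A ->
  forall x y, annihilates I J (x ** y).
Proof.
move=> chiefIJ [m low0]; have [idI idJ sIJ nJI _] := chiefIJ.
have Il x u : u \in I -> x ** u \in I by move/idI => /(_ x)[].
pose P j := forall x y : A, (x ** y) ** j \in I.
suff PJ: {in J, forall j, P j} by move=> x y j /PJ.
apply: (chief_factor_ind chiefIJ).
- split=> [x y|a u v Pu Pv x y]; first by rewrite lmul0r mem0v.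
  by rewrite lmulDr lmulZr memvD ?memvZ.
- by move=> u uI x y; apply: Il.
- by move=> x u uJ Pu y z; rewrite lmul_leibniz memvD ?Pu // Il ?Pu.
have{low0} lowJ: (iter m (sprod (sprod fullv fullv)) J <= I)%VS.
  apply: subv_trans (sub0v I); rewrite -low0; elim: (m) => [|k IHk] /=.
    exact: subvf.
  exact: sprodS.
elim: m {-2 5}J (subvv J) nJI lowJ => [|m IHm] U sUJ nUI lowU.
  by case/negP: nUI.
have [/sprod_subP UI | nUI'] := boolP (sprod (sprod fullv fullv) U <= I)%VS.
  have [j jU jI] := subvPn nUI; exists j; last by rewrite (subvP sUJ).
  by move=> x y; apply: UI => //; apply: mem_sprod; apply: memvf.
apply: (IHm _ _ nUI'); last by rewrite -iterSr.
by apply/sprod_subP=> s u _ /(subvP sUJ)/idJ-/(_ s)[].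
Qed.

End Flag.

Section ClosedFlag.
Variables (K : closedFieldType) (A : leibnizType K).
Hypothesis nilA : sqr_left_nilpotent A.
Implicit Types (I J U W : {vspace A}).

(** Left multiplications commute on J / I, so an eigenspace of one of them is
    stable under all. *)
Lemma chief_factor_scalar I J x :
  chief_factor I J -> exists a, {in J, forall j, x ** j - a *: j \in I}.
Proof.
move=> chiefIJ; have [idI idJ _ _ _] := chiefIJ.
have ann := annihilates_of_nilpotent chiefIJ nilA.
have [v vJ vI] := chief_factor_exists chiefIJ.
have xJ u : u \in J -> x ** u \in J by move/idJ => /(_ x)[].
have [a [w [wJ wI xw]]] := @eigenvector_mod _ _ (lmul x) I J v xJ vJ vI.
exists a; apply: (chief_factor_ind chiefIJ); last by exists w.
- split=> [|b u t uI tI]; first by rewrite lmul0r scaler0 subrr mem0v.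
  rewrite lmulDr lmulZr scalerDr opprD addrACA memvD //.
  by rewrite scalerA [a * b]mulrC -scalerA -scalerBr memvZ.
- by move=> u uI; rewrite memvB ?memvZ //; have [] := idI x u uI.
move=> y u uJ xuI; rewrite lmul_leibniz -addrA -lmulZr -lmulBr.
by rewrite memvD ?ann //; have [] := idI y _ xuI.
Qed.

Lemma chief_factor_line I J v :
    chief_factor I J -> v \in J -> ideal (I + <[v]>)%VS.
Proof.
move=> chiefIJ vJ x _ /memv_addP[i iI [_ /vlineP[b ->] ->]].
have [idI _ _ _ _] := chiefIJ; have [xi ix] := idI x i iI.
have [a xa] := chief_factor_scalar x chiefIJ.
have sI: {subset I <= (I + <[v]>)%VS} by apply/subvP/addvSl.
have vV: v \in (I + <[v]>)%VS by rewrite (subvP (addvSr _ _)) ?memv_line.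
have xv: x ** v \in (I + <[v]>)%VS.
  by rewrite -(subrK (a *: v) (x ** v)) memvD ?memvZ // sI ?xa.
have vx: v ** x \in (I + <[v]>)%VS.
  have [alt | sym] := chief_factor_bimodule chiefIJ; first by rewrite sI ?alt.
  by rewrite -(addrK (x ** v) (v ** x)) memvB // sI ?sym.
by rewrite lmulDr lmulDl lmulZl lmulZr !memvD ?memvZ // sI.
Qed.

Lemma exists_ideal_flag :
  exists2 e : (\dim {:A}).-tuple A, free e & forall k, ideal <<take k e>>%VS.
Proof.
suff [e size_e [free_e ide]]: exists2 e : seq A, size e = \dim {:A} &
    free e /\ forall k, ideal <<take k e>>%VS.
  by exists (tcast size_e (in_tuple e)); [|move=> k]; rewrite ?val_tcast.
have: (\dim {:A} <= \dim {:A})%N by [].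
elim: {1 3}(\dim {:A})%N => [|k IHk] lt_k.
  exists [::] => //; split=> [|k x u]; first by rewrite /free span_nil dimv0.
  by rewrite /= span_nil memv0 => /eqP->; rewrite lmul0l lmul0r mem0v.
have [e size_e [free_e ide]] := IHk (ltnW lt_k).
have nIA: ~~ (fullv <= <<e>>)%VS.
  apply: contraL lt_k => /dimvS; rewrite -leqNgt -size_e => /leq_trans; apply.
  exact: dim_span.
have idI: ideal <<e>>%VS by rewrite -(take_size e).
have [J chiefIJ] := exists_chief_factor idI nIA.
have [v vJ vI] := chief_factor_exists chiefIJ.
exists (rcons e v); rewrite ?size_rcons ?size_e //; split=> [|i].
  by rewrite -cats1 (perm_free (permEl (perm_catC _ _))) /= free_cons vI.
have [le_i | lt_i] := leqP i (size e).
  by rewrite -cats1 takel_cat.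
rewrite take_oversize ?size_rcons // -cats1 span_cat span_seq1.
exact: chief_factor_line chiefIJ vJ.
Qed.

Lemma coord_span_take n (e : n.-tuple A) k (i : 'I_n) u :
  free e -> u \in <<take k e>>%VS -> (k <= i)%N -> coord e i u = 0.
Proof.
move=> free_e; pose P u := (k <= i)%N -> coord e i u = 0.
have [|U defU] := @subspace_comprehension _ _ P.
  split=> [_|a v w Pv Pw le_ki]; first by rewrite linear0.
  by rewrite linearD linearZ /= Pv ?Pw // mulr0 addr0.
suff /subvP sub: (<<take k e>> <= U)%VS by move=> /sub/defU.
apply/span_subvP=> v v_take; apply/defU => le_ki.
have lt_v := v_take; rewrite -index_mem in lt_v; set j := index _ _ in lt_v.
have lt_jk: (j < k)%N by apply: leq_trans lt_v _; rewrite size_take_min geq_minl.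
have lt_jn: (j < n)%N by apply: leq_trans lt_jk (leq_trans le_ki (ltnW _)).
rewrite -(nth_index 0 v_take) -/j nth_take //.
rewrite (coord_free (Ordinal lt_jn) i free_e) -val_eqE /=.
by case: eqP => // ij; move: le_ki; rewrite -ij leqNgt lt_jk.
Qed.

Lemma exists_triangulating_basis :
  exists2 e : (\dim {:A}).-tuple A, basis_of {:A} e &
    forall x : A,
      is_upper_trig_mx (matrix_in_basis e (fun a => x ** a)) /\
      is_upper_trig_mx (matrix_in_basis e (fun a => a ** x)).
Proof.
have [e free_e ide] := exists_ideal_flag; exists e.
  by rewrite basisEfree free_e subvf size_tuple leqnn.
suff trig f : (forall k, {in <<take k e>>%VS, forall u, f u \in <<take k e>>%VS}) ->
    is_upper_trig_mx (matrix_in_basis e f).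
  by move=> x; split; apply: trig => k u /ide-/(_ x)[].
move=> f_stable; apply/is_trig_mxP => j i lt_ji; rewrite !mxE.
apply: (@coord_span_take _ _ j.+1) => //; apply: f_stable.
apply: memv_span; rewrite -(nth_take 0 (ltnSn j)) mem_nth //.
by rewrite size_take size_tuple; case: ifP.
Qed.

End ClosedFlag.

(** * Products in a triangulable algebra act nilpotently *)

Section TriangularBasis.
Variables (K : fieldType) (A : leibnizType K) (n : nat) (e : n.-tuple A).
Hypothesis basis_e : basis_of {:A} e.
Hypothesis trig_e : forall x : A,
  is_upper_trig_mx (matrix_in_basis e (fun a => x ** a)).

Let flag k := <<take k e>>%VS.

Let flag_mono i k : (i <= k)%N -> {subset flag i <= flag k}.
Proof.
move=> le_ik; apply/subvP/sub_span => u.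
by rewrite -(subnK le_ik) addnC takeD mem_cat => ->.
Qed.

Let flag_ind k (P : A -> Prop) :
    subspace_pred P -> (forall i : 'I_n, (i < k)%N -> P e`_i) ->
  {in flag k, forall u, P u}.
Proof.
move=> Psub Pe; apply: span_ind => // u u_k; have := u_k.
rewrite -index_mem -{2}(nth_index 0 u_k); set i := index _ _ => lt_i.
have lt_ik: (i < k)%N by apply: leq_trans lt_i _; rewrite size_take_min geq_minl.
have lt_in: (i < n)%N.
  by rewrite -(size_tuple e); apply: leq_trans lt_i _; rewrite size_take_min geq_minr.
by rewrite nth_take //; apply: (Pe (Ordinal lt_in)).
Qed.

Let mem_flag (i : 'I_n) k : (i < k)%N -> e`_i \in flag k.
Proof.
move=> lt_ik; apply: memv_span; rewrite -(nth_take 0 lt_ik) mem_nth //.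
by rewrite size_take size_tuple; case: ifP.
Qed.

Let lmul_diag x (j : 'I_n) : x ** e`_j - coord e j (x ** e`_j) *: e`_j \in flag j.
Proof.
rewrite {1}(coord_basis basis_e (memvf (x ** e`_j))) (bigD1 j) //= addrAC subrr add0r.
apply: memv_suml => i ij; have [lt_ij | le_ji] := ltnP i j.
  by rewrite memvZ // mem_flag.
have lt_ji: (j < i)%N by rewrite ltn_neqAle le_ji andbT eq_sym.
have /is_trig_mxP/(_ j i lt_ji) := trig_e x.
by rewrite !mxE => ->; rewrite scale0r mem0v.
Qed.

Let lmul_flag x k : {in flag k, forall u, x ** u \in flag k}.
Proof.
apply: flag_ind => [|i lt_ik].
  split=> [|a u v xu xv]; first by rewrite lmul0r mem0v.
  by rewrite lmulDr lmulZr memvD ?memvZ.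
rewrite -(subrK (coord e i (x ** e`_i) *: e`_i) (x ** e`_i)) memvD //.
  exact: flag_mono (ltnW lt_ik) _ (lmul_diag x i).
by rewrite memvZ ?mem_flag.
Qed.

(* With a, b the diagonal coefficients of x, y, the commutator of the triangular
   operators has diagonal coefficient a b - b a = 0. *)
Let lmul_prod_flag x y k : {in flag k.+1, forall u, (x ** y) ** u \in flag k}.
Proof.
apply: flag_ind => [|i lt_ik].
  split=> [|a u v xu xv]; first by rewrite lmul0r mem0v.
  by rewrite lmulDr lmulZr memvD ?memvZ.
apply: (@flag_mono i k lt_ik).
set a := coord e i (x ** e`_i); set b := coord e i (y ** e`_i).
have xr := lmul_diag x i; have yr := lmul_diag y i; rewrite -/a -/b in xr yr.
have -> : (x ** y) ** e`_i =
    x ** (y ** e`_i - b *: e`_i) - y ** (x ** e`_i - a *: e`_i)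
      + (b *: (x ** e`_i - a *: e`_i) - a *: (y ** e`_i - b *: e`_i)).
  rewrite lmul_prod !lmulBr !lmulZr !scalerBr !scalerA [b * a]mulrC.
  set X := x ** _; set Y := y ** _; set B := b *: _; set C := a *: _.
  rewrite !opprB [B - _ + _]addrA subrK [X - B + _]addrC [RHS]addrA.
  by rewrite [_ + (X - B)]addrA subrK addrAC [C - Y - C]addrAC subrr add0r addrC.
apply: memvD; apply: memvB; rewrite ?memvZ //; exact: lmul_flag.
Qed.

Lemma lmul_prod_nilpotent (x y u : A) : iter n (lmul (x ** y)) u = 0.
Proof.
have: u \in flag n.
  by rewrite /flag take_oversize ?size_tuple // (span_basis basis_e) memvf.
elim: {1 2}n u => [|k IHk] u; first by rewrite /flag take0 span_nil memv0 => /eqP.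
by move=> /lmul_prod_flag uk; rewrite iterSr; apply: IHk.
Qed.

End TriangularBasis.

(** * Extension of scalars *)

Section ScalarExtensionNilpotent.
Variables (F K : fieldType) (iota : {rmorphism F -> K}) (N : leibnizType F).
Local Notation NK := (scalar_ext N iota).
Local Notation inK := (@scalar_ext_in F K iota N).
Implicit Types U W : {vspace N}.

Lemma scalar_ext_inZ a u : inK (a *: u) = iota a *: inK u.
Proof. by apply/rowP=> k; rewrite !mxE linearZ rmorphM. Qed.

Lemma scalar_ext_in0 : inK 0 = 0.
Proof. by apply/rowP=> k; rewrite !mxE linear0 rmorph0. Qed.

Lemma scalar_ext_in_inj u : inK u = 0 -> u = 0.
Proof.
move=> /rowP u0; rewrite (coord_vbasis (memvf u)) big1 // => i _.
by have:= u0 i; rewrite !mxE => /eqP; rewrite fmorph_eq0 => /eqP->; rewrite scale0r.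
Qed.

Definition scalar_ext_vspace U : {vspace NK} := <<[seq inK u | u <- vbasis U]>>%VS.

Lemma mem_scalar_ext U u : u \in U -> (inK u : NK) \in scalar_ext_vspace U.
Proof.
move=> /coord_vbasis ->.
have in_sum I r (f : I -> N) : inK (\sum_(i <- r) f i) = \sum_(i <- r) inK (f i).
  elim: r => [|i r IHr]; first by rewrite !big_nil scalar_ext_in0.
  by rewrite !big_cons scalar_ext_inD IHr.
rewrite in_sum; apply: memv_suml => i _; rewrite scalar_ext_inZ memvZ //.
by apply/memv_span/map_f/mem_nth; rewrite size_tuple.
Qed.

Lemma sprod_scalar_ext U W :
  (sprod (scalar_ext_vspace U) (scalar_ext_vspace W)
     <= scalar_ext_vspace (sprod U W))%VS.
Proof.
set E := scalar_ext_vspace (sprod U W).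
apply/sprod_subP=> x y xU; move: y; apply: span_ind => [|_ /mapP[w /vbasis_mem wW ->]].
  split=> [|a u v xu xv]; first by rewrite lmul0r mem0v.
  by rewrite lmulDr lmulZr memvD ?memvZ.
move: x xU; apply: span_ind => [|_ /mapP[u /vbasis_mem uU ->]].
  split=> [|a u v xu xv]; first by rewrite lmul0l mem0v.
  by rewrite lmulDl lmulZl memvD ?memvZ.
have -> : (inK u : NK) ** (inK w : NK) = inK (u ** w) by rewrite scalar_ext_in_mul.
by apply/mem_scalar_ext/mem_sprod.
Qed.

Lemma scalar_ext_left_nilpotent : sqr_left_nilpotent N -> sqr_left_nilpotent NK.
Proof.
move=> [m low0]; exists m; apply/eqP; rewrite -subv0.
have ext0: (scalar_ext_vspace 0 <= 0)%VS.
  apply/span_subvP=> _ /mapP[u /vbasis_mem + ->].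
  by rewrite memv0 => /eqP->; rewrite scalar_ext_in0 mem0v.
have extT: (fullv <= scalar_ext_vspace fullv)%VS.
  apply/subvP=> x _; rewrite [x]scalar_ext_sum memv_suml // => i _.
  by rewrite memvZ // mem_scalar_ext ?memvf.
apply: subv_trans ext0; rewrite -low0; elim: (m) => [|k IHk]; first exact: extT.
apply: subv_trans (sprod_scalar_ext _ _); apply: sprodS IHk.
exact: subv_trans (sprodS extT extT) (sprod_scalar_ext _ _).
Qed.

Lemma triangulable_nilpotent (u v w : N) : triangulable iota N ->
  iter (\dim {:N}) (lmul (u ** v)) w = 0.
Proof.
case=> e basis_e trig_e; apply: scalar_ext_in_inj.
have in_iter k : inK (iter k (lmul (u ** v)) w)
    = iter k (lmul ((inK u : NK) ** (inK v : NK))) (inK w : NK).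
  by elim: k => //= k <-; rewrite !scalar_ext_in_mul.
rewrite in_iter.
have -> : \dim {:N} = \dim {:NK} by rewrite (dimvf NK) /dim /= mul1n.
by apply: (lmul_prod_nilpotent basis_e) => x; have [] := trig_e x.
Qed.

End ScalarExtensionNilpotent.

(** * Triangulability is 2-recognizable *)

Theorem theorem4 (F : fieldType) (K : closedFieldType)
    (iota : {rmorphism F -> K}) (algK : forall z : K, algebraicOver iota z) :
  recognizable 2 (@solvable_leibniz F) (triangulable iota).
Proof.
move=> A solA trigA; suff nilA: sqr_left_nilpotent A.
  exact: exists_triangulating_basis (scalar_ext_left_nilpotent iota nilA).
apply: (@sqr_left_nilpotent_engel _ _ (\dim {:A})) => // x y.
have [S genS] := generated_subalgebra_exists [:: x; y].
have trigS := trigA [tuple x; y] S genS; have [xyS _] := genS.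
have Snil z : z \in S -> iter (\dim {:A}) (lmul (x ** y)) z = 0.
  have xS: x \in S by apply: xyS; rewrite mem_head.
  have yS: y \in S by apply: xyS; rewrite inE mem_head orbT.
  move=> zS; have le_dim: (\dim {:subalg_of S} <= \dim {:A})%N.
    by rewrite (dimvf (subvs_of S)) dimvS ?subvf.
  rewrite -(subnK le_dim) iterD.
  have := triangulable_nilpotent (Subvs xS : subalg_of S) (Subvs yS) (Subvs zS) trigS.
  set k := \dim {:subalg_of S} => nil_k.
  have -> : iter k (lmul (x ** y)) z = 0.
    move/(congr1 val): nil_k; rewrite /= => <-.
    by elim: (k) => //= i ->.
  by elim: (_ - _)%N => //= i ->; rewrite lmul0r.
by split; apply/Snil/xyS; rewrite !inE eqxx ?orbT.
Qed.
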